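(* Let $q,s,r,n$ be integers with $2\le q<s$, $r\ge 1$ and $n\ge qr^2$. If $\mathcal{F}\subseteq \{0,1,\dots,q\}^n$ is $r$-support uniform and $s$-sum intersecting, then \[ |\mathcal{F}|\le \begin{cases} \left(q-\frac{s}{2}+1\right) q^{r-1}\binom{n-1}{r-1} & \text{if } s \text{ is even},\\[4pt] 1+\left(q-\lceil\frac{s}{2}\rceil+1\right)\sum_{i=1}^r \binom{n-i}{r-i}q^{r-i} & \text{if } s \text{ is odd}, \end{cases} \] and these bounds are best possible.
   Context: For $\mathbf{x}\in\{0,1,\dots,q\}^n$, its support is $S_{\mathbf{x}}=\{i: x_i\neq 0\}$; a family $\mathcal{F}$ is $r$-support uniform if $|S_{\mathbf{x}}|=r$ for every $\mathbf{x}\in\mathcal{F}$. For $\mathbf{x},\mathbf{y}\in\{0,1,\dots,q\}^n$, the size of their $s$-sum intersection is $|\{i\in[n]: x_i+y_i\ge s\}|$, and $\mathbf{x},\mathbf{y}$ are $s$-sum intersecting if this is at least $1$. A family is $s$-sum intersecting if any two distinct members are $s$-sum intersecting.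
   Formalization: The hypothesis s ≤ 2q+1 is added: for s ≥ 2q+2 the stated bound is below 1, while a family with a single vector of support size r is vacuously s-sum intersecting, so the claim fails there. *)

(* Defs.v *)
From mathcomp Require Import all_boot.

Set Implicit Arguments.
Unset Strict Implicit.
Unset Printing Implicit Defensive.

(* {0, 1, ..., q}^n, with coordinates indexed by 'I_n in place of [n]. *)
Definition qvec (q n : nat) := {ffun 'I_n -> 'I_q.+1}.

Section SumIntersection.
Variables q n : nat.
Implicit Types (x y : qvec q n) (F : {set qvec q n}).

Definition support x : {set 'I_n} := [set i | (x i : nat) != 0].

Definition support_uniform (r : nat) F : Prop :=
  forall x, x \in F -> #|support x| = r.

Definition sum_intersection (s : nat) x y : {set 'I_n} :=
  [set i | s <= (x i : nat) + (y i : nat)].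

Definition sum_intersect (s : nat) x y : Prop := 1 <= #|sum_intersection s x y|.

Definition sum_intersecting (s : nat) F : Prop :=
  forall x y, x \in F -> y \in F -> x != y -> sum_intersect s x y.

End SumIntersection.

(* [uphalf s] is the ceiling of s/2.  The factor q - ceil(s/2) + 1 is written  *)
(* q.+1 - ceil(s/2): truncated subtraction is then exact for s <= 2q + 1,      *)
(* including s = 2q + 1, where the factor is 0.                                *)
Definition sum_bound (q s r n : nat) : nat :=
  if odd s then
    1 + (q.+1 - uphalf s) * \sum_(1 <= i < r.+1) 'C(n - i, r - i) * q ^ (r - i)
  else (q.+1 - s./2) * q ^ (r - 1) * 'C(n - 1, r - 1).

(* Main.v *)
(** Write c for the ceiling of s/2, call an entry heavy if it is at least c, and
    put p = q + 1 - c. Swapping entries x_i < x_j with i < j preserves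
    s-sum intersection, so F may be assumed left-shifted. At most one member of
    F has no heavy entry, and every other member has a prefix with more heavy
    entries than zeros: otherwise its heavy entries could be moved to distinct
    earlier zeros, giving a member of F that it does not meet. A ballot-type
    recursion bounds the number of vectors with such a prefix by
    p q^(r-1) C(n,r-1).
    If some x in F has x_1 + c < s, then F contains no y with y_1 = c whose other
    support avoids that of x, and for n >= q r^2 this loss brings the bound down
    to p q^(r-1) C(n-1,r-1). Otherwise x_1 >= s - c on F: for even s the bound is
    immediate, and for odd s the slice x_1 = c - 1 is again s-sum intersecting,
    with supports of size r - 1, so induction on r applies. *)

From mathcomp Require Import all_boot zify_ssreflect.
Require Import Defs.

Set Implicit Arguments.
Unset Strict Implicit.
Unset Printing Implicit Defensive.

(** * Splitting off the first entry, and counting vectors by support *)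

Section Vectors.
Variable q : nat.

Definition vcons n (a : 'I_q.+1) (x : qvec q n) : qvec q n.+1 :=
  [ffun i => if unlift ord0 i is Some j then x j else a].

Lemma vcons0 n a (x : qvec q n) : vcons a x ord0 = a.
Proof. by rewrite ffunE unlift_none. Qed.

Lemma vconsS n a (x : qvec q n) i : vcons a x (lift ord0 i) = x i.
Proof. by rewrite ffunE liftK. Qed.

Definition vtail n (x : qvec q n.+1) : qvec q n := [ffun i => x (lift ord0 i)].

Lemma vtailE n (x : qvec q n.+1) i : vtail x i = x (lift ord0 i).
Proof. by rewrite ffunE. Qed.

Lemma vcons_vtail n (x : qvec q n.+1) : vcons (x ord0) (vtail x) = x.
Proof.
by apply/ffunP => i; rewrite ffunE; case: unliftP => [j|] ->; rewrite ?ffunE.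
Qed.

Lemma vtail_vcons n a (x : qvec q n) : vtail (vcons a x) = x.
Proof. by apply/ffunP => i; rewrite vtailE vconsS. Qed.

Lemma card_vcons n (P : pred (qvec q n.+1)) :
  #|[set x | P x]| = \sum_(a < q.+1) #|[set x | P (vcons a x)]|.
Proof.
rewrite -sum1dep_card (reindex (fun u => vcons u.1 u.2)) /=; last first.
  exists (fun x : qvec q n.+1 => (x ord0, vtail x)) => [[a x] _|x _] /=.
    by rewrite vcons0 vtail_vcons.
  by rewrite vcons_vtail.
rewrite (eq_bigr (fun a => \sum_(x | P (vcons a x)) 1)); last first.
  by move=> a _; rewrite -sum1dep_card.
by rewrite pair_big_dep.
Qed.

Lemma card_ord_recl n (Q : pred 'I_n.+1) :
  #|[set i | Q i]| = Q ord0 + #|[set i | Q (lift ord0 i)]|.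
Proof.
rewrite -!sum1dep_card big_mkcond big_ord_recl [in RHS]big_mkcond /=.
by case: (Q ord0).
Qed.

Lemma card_support_vcons n a (x : qvec q n) :
  #|support (vcons a x)| = (a != 0 :> nat) + #|support x|.
Proof.
rewrite /support card_ord_recl vcons0; congr (_ + _).
by apply: eq_card => i; rewrite !inE vconsS.
Qed.

Lemma sum_threshold c (F : nat -> nat) K : c <= q.+1 ->
  \sum_(a < q.+1) (if a < c then F a else K) =
    \sum_(a < c) F a + (q.+1 - c) * K.
Proof.
move=> le_cq; rewrite -(big_mkord predT (fun a => if a < c then F a else K)).
rewrite (big_cat_nat (leq0n c) le_cq) /= -(big_mkord predT F); congr (_ + _).
  by apply: eq_big_nat => a /andP[_ ->].
rewrite (eq_big_nat _ _ (F2 := fun=> K)) ?sum_nat_const_nat //.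
by move=> a /andP[le_ca _]; rewrite ltnNge le_ca.
Qed.

Lemma card_support_eq n r :
  #|[set x : qvec q n | #|support x| == r]| = 'C(n, r) * q ^ r.
Proof.
elim: n r => [|n IHn] r.
  have supp0 (x : qvec q 0) : #|support x| = 0.
    by apply: eq_card0 => -[].
  case: r => [|r].
    rewrite bin0 mul1n expn0 (eq_card (B := predT)) ?card_ffun ?card_ord //.
    by move=> x; rewrite !inE supp0.
  by rewrite bin0n mul0n; apply: eq_card0 => x; rewrite !inE supp0.
rewrite card_vcons big_ord_recl.
have -> : #|[set x : qvec q n | #|support (vcons ord0 x)| == r]| = 'C(n, r) * q ^ r.
  by rewrite -IHn; apply: eq_card => x; rewrite !inE card_support_vcons.
case: r => [|r].
  rewrite big1 ?bin0 ?addn0 // => a _.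
  by apply: eq_card0 => x; rewrite !inE card_support_vcons.
rewrite (eq_bigr (fun=> 'C(n, r) * q ^ r)) => [|a _].
  by rewrite sum_nat_const card_ord binS expnS; nia.
by rewrite -IHn; apply: eq_card => x; rewrite !inE card_support_vcons.
Qed.

(** The [r] nonzero positions are chosen outside [support x], with [q] values at each. This later
    measures how many vectors a member with a small first entry excludes. *)
Lemma card_disjoint_support n r (x : qvec q n) :
  #|[set y : qvec q n | (#|support y| == r) && [disjoint support x & support y]]|
  = 'C(n - #|support x|, r) * q ^ r.
Proof.
have dvcons m a b (u v : qvec q m) :
    [disjoint support (vcons a u) & support (vcons b v)] =
      ((a == 0 :> nat) || (b == 0 :> nat)) && [disjoint support u & support v].
  apply/pred0P/andP => [dis | [ab /pred0P dis] i]; last first.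
    rewrite !inE; case: (unliftP ord0 i) => [j|] ->.
      by have := dis j; rewrite !inE !vconsS.
    by rewrite !vcons0; case: eqP ab => //= _ ->.
  split; first by have := dis ord0; rewrite !inE !vcons0; do 2 case: eqP.
  by apply/pred0P => j; have := dis (lift ord0 j); rewrite !inE !vconsS.
elim: n r x => [|n IHn] r x.
  rewrite sub0n -card_support_eq; apply: eq_card => y; rewrite !inE.
  by rewrite (_ : [disjoint _ & _]) ?andbT //; apply/pred0P => -[].
rewrite -(vcons_vtail x) card_support_vcons card_vcons big_ord_recl.
set u := vtail x; set a := x ord0.
have -> : #|[set y : qvec q n | (#|support (vcons ord0 y)| == r) &&
      [disjoint support (vcons a u) & support (vcons ord0 y)]]|
    = 'C(n - #|support u|, r) * q ^ r.
  rewrite -IHn; apply: eq_card => y.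
  by rewrite !inE card_support_vcons dvcons orbT.
have le_un : #|support u| <= n by rewrite -[leqRHS]card_ord max_card.
have [a0|a_neq0] := eqVneq (a : nat) 0; last first.
  rewrite add1n subSS big1 ?addn0 // => b _; apply: eq_card0 => y.
  by rewrite !inE dvcons (negPf a_neq0) andbF.
rewrite add0n subSn //; case: r => [|r].
  rewrite big1 ?bin0 ?addn0 // => b _.
  by apply: eq_card0 => y; rewrite !inE card_support_vcons.
rewrite (eq_bigr (fun=> 'C(n - #|support u|, r) * q ^ r)) => [|b _].
  by rewrite sum_nat_const card_ord binS expnS; nia.
by rewrite -IHn; apply: eq_card => y; rewrite !inE card_support_vcons dvcons a0.
Qed.

End Vectors.

(** * Ballot-type count of vectors whose path attains a given height *)

Section Prefixes.
Variables q c : nat.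
Hypothesis c_gt0 : 0 < c.

Definition prefix_zeros n k (x : qvec q n) : {set 'I_n} :=
  [set i : 'I_n | (i < k) && (x i == 0 :> nat)].
Definition prefix_heavy n k (x : qvec q n) : {set 'I_n} :=
  [set i : 'I_n | (i < k) && (c <= x i)].

(* With steps -1 on zeros, +1 on entries at least c and 0 on the other entries, *)
(* the lattice path of x attains height h.                                      *)
Definition reaches n h (x : qvec q n) : bool :=
  [exists k : 'I_n.+1, h + #|prefix_zeros k x| <= #|prefix_heavy k x|].

Lemma reaches_le_support n h (x : qvec q n) : reaches h x -> h <= #|support x|.
Proof.
case/existsP => k le_h; have: #|prefix_heavy k x| <= #|support x|.
  by apply/subset_leq_card/subsetP => i; rewrite !inE; lia.
by lia.
Qed.

Lemma card_prefix_zeros_vcons n k a (x : qvec q n) :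
  #|prefix_zeros k.+1 (vcons a x)| = (a == 0 :> nat) + #|prefix_zeros k x|.
Proof.
rewrite /prefix_zeros card_ord_recl vcons0; congr (_ + _).
by apply: eq_card => i; rewrite !inE vconsS.
Qed.

Lemma card_prefix_heavy_vcons n k a (x : qvec q n) :
  #|prefix_heavy k.+1 (vcons a x)| = (c <= a) + #|prefix_heavy k x|.
Proof.
rewrite /prefix_heavy card_ord_recl vcons0; congr (_ + _).
by apply: eq_card => i; rewrite !inE vconsS.
Qed.

(** Removing the first entry changes the height still to be attained: a zero raises it, a heavy
    entry lowers it. The target is positive, so the empty prefix cannot be the witness. *)
Lemma reaches_vcons n h a (x : qvec q n) : reaches h.+1 (vcons a x) ->
  reaches (if a == 0 :> nat then h.+2 else if a < c then h.+1 else h) x.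
Proof.
case/existsP => -[[|k] lt_kn].
  have -> : #|prefix_heavy (Ordinal lt_kn) (vcons a x)| = 0.
    by apply: eq_card0 => i; rewrite !inE.
  by lia.
rewrite card_prefix_zeros_vcons card_prefix_heavy_vcons => le_h.
apply/existsP; exists (Ordinal (lt_kn : k < n.+1)).
rewrite -[X in prefix_zeros X _]/k -[X in prefix_heavy X _]/k.
move: #|prefix_zeros k x| #|prefix_heavy k x| le_h => u v.
by case: (a =P 0 :> nat) => a0; case: (ltnP a c) => ca; lia.
Qed.

(** Induction on [n], splitting by the first entry. From target [h + 1], the zero, the [c - 1] light
    nonzero values and the [p = q + 1 - c] heavy values lead to targets [h + 2], [h + 1] and [h]. As
    [p + (c - 1) = q], the first two contributions merge, and Pascal's rule closes the recursion. *)
Lemma card_reaches n h d : c <= q.+1 ->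
  #|[set x : qvec q n | (#|support x| == h + d) && reaches h x]|
    <= (q.+1 - c) ^ h * q ^ d * 'C(n, d).
Proof.
move=> le_cq; elim: n h d => [|n IHn] [|h] d.
- rewrite expn0 mul1n mulnC -card_support_eq.
  by apply/subset_leq_card/subsetP => x; rewrite !inE => /andP[].
- rewrite (_ : #|_| = 0) //; apply: eq_card0 => x; rewrite !inE.
  apply/negP => /andP[_] /existsP[k].
  by rewrite [X in _ <= X]eq_card0 // => -[].
- rewrite expn0 mul1n mulnC -card_support_eq.
  by apply/subset_leq_card/subsetP => x; rewrite !inE => /andP[].
set p := q.+1 - c; rewrite card_vcons.
(* For [d = 0] a first entry below [c] leaves fewer nonzero entries in the tail than the height to
   be attained, hence the value 0. *)
pose A := if d is d'.+1 then p ^ h.+2 * q ^ d' * 'C(n, d') else 0.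
pose B := if d is d'.+1 then p ^ h.+1 * q ^ d' * 'C(n, d') else 0.
pose K := p ^ h * q ^ d * 'C(n, d).
apply: (@leq_trans (\sum_(a < q.+1)
    (if a < c then (if a == 0 :> nat then A else B) else K))).
  apply: leq_sum => a _.
  have [a0|a_neq0] := eqVneq (a : nat) 0.
    rewrite a0 c_gt0 /A; case: d {A B K} => [|d].
      rewrite leqn0 cards_eq0 -subset0; apply/subsetP => x; rewrite !inE.
      rewrite card_support_vcons a0 eqxx add0n => /andP[/eqP supp_x] /reaches_vcons.
      by rewrite a0 eqxx => /reaches_le_support; lia.
    apply: leq_trans (IHn _ _); apply/subset_leq_card/subsetP => x.
    rewrite !inE card_support_vcons a0 eqxx add0n => /andP[/eqP supp_x] /reaches_vcons.
    by rewrite a0 eqxx => ->; rewrite andbT; apply/eqP; lia.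
  case: ltnP => ca; last first.
    apply: leq_trans (IHn _ _); apply/subset_leq_card/subsetP => x.
    rewrite !inE card_support_vcons a_neq0 => /andP[/eqP supp_x] /reaches_vcons.
    rewrite (negPf a_neq0) ltnNge ca => ->; rewrite andbT; apply/eqP; lia.
  rewrite /B; case: d {A B K} => [|d].
    rewrite leqn0 cards_eq0 -subset0; apply/subsetP => x; rewrite !inE.
    rewrite card_support_vcons a_neq0 => /andP[/eqP supp_x] /reaches_vcons.
    by rewrite (negPf a_neq0) ca => /reaches_le_support; lia.
  apply: leq_trans (IHn _ _); apply/subset_leq_card/subsetP => x.
  rewrite !inE card_support_vcons a_neq0 => /andP[/eqP supp_x] /reaches_vcons.
  by rewrite (negPf a_neq0) ca => ->; rewrite andbT; apply/eqP; lia.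
rewrite (sum_threshold (fun a => if a == 0 then A else B)) // -/p.
have -> : \sum_(a < c) (if a == 0 :> nat then A else B) = A + c.-1 * B.
  by case: c c_gt0 => // c' _; rewrite big_ord_recl /= sum_nat_const card_ord.
have def_q : q = c.-1 + p by rewrite /p; lia.
rewrite /A /B /K; case: d {A B K} => [|d].
  by rewrite !bin0 expnS; lia.
rewrite binS !expnS.
set X := p ^ h; set Y := q ^ d; set U := 'C(n, d); set V := 'C(n, d.+1).
move: p X Y U V def_q => p X Y U V def_q; rewrite !{}def_q; nia.
Qed.

End Prefixes.

(** * Left-shifting of sum-intersecting families *)

Section Shifting.
Variables q n : nat.
Implicit Types (x y : qvec q n) (F G : {set qvec q n}).

Lemma sum_intersectP s x y :
  reflect (exists k, s <= x k + y k) (0 < #|sum_intersection s x y|).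
Proof.
rewrite card_gt0; apply: (iffP (set0Pn _)) => -[k]; rewrite ?inE => xyk.
  by exists k.
by exists k; rewrite inE.
Qed.

Definition transp (i j k : 'I_n) := if k == i then j else if k == j then i else k.

Lemma transpK i j : involutive (transp i j).
Proof.
move=> k; rewrite /transp; have [->|ki] := eqVneq k i.
  by rewrite eqxx; case: eqVneq.
by have [->|kj] := eqVneq k j; rewrite ?eqxx // (negPf ki) (negPf kj).
Qed.

Definition vswap i j x : qvec q n := [ffun k => x (transp i j k)].

Lemma vswapE i j x k : vswap i j x k = x (transp i j k).
Proof. by rewrite ffunE. Qed.

Lemma vswapl i j x : vswap i j x i = x j.
Proof. by rewrite vswapE /transp eqxx. Qed.

Lemma vswapr i j x : vswap i j x j = x i.
Proof. by rewrite vswapE /transp eqxx; case: eqVneq => // ->. Qed.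

Lemma vswap_id i j x k : k != i -> k != j -> vswap i j x k = x k.
Proof. by move=> ki kj; rewrite vswapE /transp (negPf ki) (negPf kj). Qed.

Lemma vswapK i j : involutive (vswap i j).
Proof. by move=> x; apply/ffunP => k; rewrite !vswapE transpK. Qed.

Lemma card_support_vswap i j x : #|support (vswap i j x)| = #|support x|.
Proof.
rewrite -[RHS](card_imset _ (inv_inj (transpK i j))); apply: eq_card => k.
rewrite inE vswapE -[k in RHS](transpK i j) mem_imset ?inE //.
exact: inv_inj (transpK i j).
Qed.

(** Potential that drops whenever a larger entry is swapped to the left. *)
Definition weight x := \sum_(k < n) k * x k.

Lemma weight_vswap (i j : 'I_n) x :
  i < j -> x i < x j -> weight (vswap i j x) < weight x.
Proof.
move=> ltij ltx; have ji : j != i by apply: contraTneq ltij => ->; rewrite ltnn.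
rewrite /weight (bigD1 i) // (bigD1 j) //= [ltnRHS](bigD1 i) // [in ltnRHS](bigD1 j) //=.
rewrite vswapl vswapr; set S := \sum_(_ < n | _) _; set S' := \sum_(_ < n | _) _.
have -> : S = S'.
  by apply: eq_bigr => k /andP[ki kj]; rewrite vswap_id.
by nia.
Qed.

Definition left_shifted F :=
  forall x (i j : 'I_n), x \in F -> i < j -> x i < x j -> vswap i j x \in F.

(** The usual compression: a vector stays put when its swap already lies in [F], which keeps the map
    injective on [F]. *)
Definition shift F (i j : 'I_n) x :=
  if (x i < x j) && (vswap i j x \notin F) then vswap i j x else x.

Lemma shift_inj F i j : {in F &, injective (shift F i j)}.
Proof.
move=> x y Fx Fy; rewrite /shift.
case: ifP => [/andP[_ nx]|_]; case: ifP => [/andP[_ ny]|_] //.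
- exact: (inv_inj (vswapK i j)).
- by move=> exy; rewrite exy Fy in nx.
by move=> exy; rewrite -exy Fx in ny.
Qed.

Lemma shift_intersecting s F i j : sum_intersecting s F ->
  sum_intersecting s [set shift F i j x | x in F].
Proof.
move=> intF _ _ /imsetP[x Fx ->] /imsetP[y Fy ->] neq.
have {neq} nxy : x != y by apply: contraNneq neq => ->.
(* Here only [x1] moves. If [y1 j <= y1 i], a meeting at [i] or [j] survives at [i], where the
   larger entries now face each other. Otherwise the swap of [y1] is in [F], and its meeting with
   [x1] is transported by the transposition. *)
have mixed x1 y1 : x1 \in F -> y1 \in F -> x1 != y1 -> x1 i < x1 j ->
    ~~ ((y1 i < y1 j) && (vswap i j y1 \notin F)) ->
    exists k, s <= vswap i j x1 k + y1 k.
  move=> Fx1 Fy1 nxy1 ltx.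
  have [ley|lty] := leqP (y1 j) (y1 i).
    have /sum_intersectP[k le_s] := intF _ _ Fx1 Fy1 nxy1.
    have [eki|nki] := eqVneq k i.
      by exists i; rewrite vswapl; rewrite eki in le_s; lia.
    have [ekj|nkj] := eqVneq k j.
      by exists i; rewrite vswapl; rewrite ekj in le_s; lia.
    by exists k; rewrite vswap_id.
  rewrite negbK => Fy1'; have nxy1' : x1 != vswap i j y1.
    by apply: contraTneq ltx => ->; rewrite vswapl vswapr -leqNgt ltnW.
  have /sum_intersectP[k le_s] := intF _ _ Fx1 Fy1' nxy1'.
  by exists (transp i j k); rewrite vswapE transpK -vswapE.
apply/sum_intersectP; rewrite /shift.
case: ifPn => [/andP[ltx nx]|cx]; case: ifPn => [/andP[lty ny]|cy].
- have /sum_intersectP[k le_s] := intF _ _ Fx Fy nxy.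
  by exists (transp i j k); rewrite !vswapE transpK.
- exact: mixed.
- have [|k] := mixed y x Fy Fx _ lty cx; first by rewrite eq_sym.
  by exists k; rewrite addnC.
by apply/sum_intersectP; apply: intF.
Qed.

(** Take a family of least total weight among those with the same size and properties: a missing
    swap would let [shift] lower that weight. *)
Lemma exists_left_shifted r s F : support_uniform r F -> sum_intersecting s F ->
  exists G, [/\ support_uniform r G, sum_intersecting s G, #|G| = #|F|
    & left_shifted G].
Proof.
move=> uniF intF.
pose P G := [&& #|G| == #|F|, [forall x in G, #|support x| == r] &
  [forall x in G, forall y in G, (x != y) ==> (0 < #|sum_intersection s x y|)]].
have PP G : reflect [/\ #|G| = #|F|, support_uniform r G & sum_intersecting s G] (P G).
  apply: (iffP and3P) => -[/eqP cG uG iG]; split=> //.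
  - by move=> x Gx; apply/eqP/(forall_inP uG).
  - move=> x y Gx Gy nxy.
    by move/forall_inP/(_ x Gx)/forall_inP/(_ y Gy)/implyP: iG; apply.
  - by apply/forall_inP => x Gx; apply/eqP/uG.
  apply/forall_inP => x Gx; apply/forall_inP => y Gy; apply/implyP; exact: iG.
have PF : P F by apply/PP.
case: (arg_minnP (fun G => \sum_(x in G) weight x) PF) => G /PP[cG uG iG] minG.
exists G; split=> // x i j Gx ltij ltx; apply: contraT => nGx.
suff /minG : P [set shift G i j y | y in G].
  rewrite big_imset /=; last exact: shift_inj.
  rewrite leqNgt => /negP[]; rewrite (bigD1 x) // [ltnRHS](bigD1 x) //= -addSn.
  apply: leq_add; first by rewrite /shift ltx nGx weight_vswap.
  apply: leq_sum => y _; rewrite /shift; case: ifP => // /andP[lty _].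
  exact/ltnW/weight_vswap.
apply/PP; split; first by rewrite card_in_imset //; exact: shift_inj.
  by move=> _ /imsetP[y Gy ->]; rewrite /shift; case: ifP; rewrite ?card_support_vswap uG.
exact: shift_intersecting.
Qed.

(** Two light entries sum to at most [2 * (uphalf s - 1) < s]. *)
Lemma light_unique s F x y : sum_intersecting s F -> x \in F -> y \in F ->
  (forall i, x i < uphalf s) -> (forall i, y i < uphalf s) -> x = y.
Proof.
move=> intF Fx Fy lx ly; apply/eqP/contraT => nxy.
have /sum_intersectP[k] := intF _ _ Fx Fy nxy.
by have := lx k; have := ly k; lia.
Qed.

(* If no prefix has more heavy entries than zeros, each heavy entry of x can be *)
(* moved to its own earlier zero; the resulting member of F does not meet x.    *)
Lemma shifted_reaches s F x : q < s -> left_shifted F -> sum_intersecting s F ->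
  x \in F -> [exists i, uphalf s <= x i] -> reaches (uphalf s) 1 x.
Proof.
set c := uphalf s => lt_qs shF intF Fx /existsP[i0 heavy_i0].
have c_gt0 : 0 < c by rewrite /c; lia.
apply: contraT => /existsPn nreach.
have le_q z (i : 'I_n) : (z : qvec q n) i <= q by rewrite -ltnS ltn_ord.
(* Invariant after [k] entries: [y] does not meet [x] on this prefix, agrees with [x] beyond it, and
   has filled no more zeros of [x] than there are heavy entries so far. *)
have step k : k <= n -> exists y, [/\ y \in F,
    forall i : 'I_n, i < k -> x i + y i < s, forall i : 'I_n, k <= i -> y i = x i
    & #|[set i in prefix_zeros k x | y i != 0 :> nat]| <= #|prefix_heavy c k x|].
  elim: k => [|k IHk] le_kn.
    by exists x; split=> //; rewrite eq_card0 // => i; rewrite !inE.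
  have [y [Fy disj same filled]] := IHk (ltnW le_kn).
  pose o := Ordinal le_kn; have yo : y o = x o by apply: same.
  have neq_o (i : 'I_n) : i <= k -> i != o -> i < k.
    by move=> le_ik nio; rewrite ltn_neqAle le_ik andbT -[k]/(val o) val_eqE.
  have [lo|ho] := ltnP (x o) c.
    exists y; split=> // [i le_ik|i lt_ki|]; last first.
    - apply: leq_trans (_ : _ <= #|prefix_heavy c k x|) _.
        apply: leq_trans filled; apply/subset_leq_card/subsetP => i.
        rewrite !inE => /andP[/andP[le_ik xi0] yi]; rewrite xi0 yi !andbT.
        apply: neq_o => //; apply: contraTneq yi => ei.
        by rewrite ei yo -ei xi0.
      by apply/subset_leq_card/subsetP => i; rewrite !inE => /andP[lt_ik ->]; rewrite ltnW.
    - exact/same/ltnW.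
    have [->|nio] := eqVneq i o; last by apply/disj/neq_o.
    by rewrite yo; lia.
  have card_heavy : #|prefix_heavy c k.+1 x| = #|prefix_heavy c k x|.+1.
    have -> : prefix_heavy c k.+1 x = o |: prefix_heavy c k x.
      apply/setP => i; rewrite !inE; have [->|nio] := eqVneq i o.
        by rewrite ho ltnSn.
      by congr (_ && _); apply/idP/idP => [/neq_o->|/ltnW].
    by rewrite cardsU1 inE ltnn.
  have card_zeros : #|prefix_zeros k.+1 x| = #|prefix_zeros k x|.
    apply: eq_card => i; rewrite !inE; have [->|nio] := eqVneq i o.
      by rewrite ltnn ltnSn /=; apply/eqP => xo0; rewrite xo0 leqn0 in ho; lia.
    by congr (_ && _); apply/idP/idP => [/neq_o->|/ltnW].
  (* If every earlier zero were filled, the prefix of length [k + 1] would have more heavy entries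
     than zeros. *)
  have [i /andP[/andP[lt_ik xi0] yi0]] :
      exists i : 'I_n, (i < k) && (x i == 0 :> nat) && (y i == 0 :> nat).
    apply/existsP/contraT => /existsPn full.
    have : #|prefix_zeros k x| <= #|prefix_heavy c k x|.
      apply: leq_trans filled; apply/subset_leq_card/subsetP => i.
      by rewrite !inE => zi; have := full i; rewrite zi.
    have := nreach (Ordinal (le_kn : k.+1 < n.+1)).
    by rewrite card_heavy card_zeros; lia.
  have nio : i != o by rewrite -val_eqE /= ltn_eqF.
  have lt_yi : y i < y o by rewrite (eqP yi0) yo; lia.
  (* At [i] the zero of [x], and at [o] the zero of the new vector, faces an entry at most
     [q < s]. *)
  exists (vswap i o y); split; first exact: shF.
  - move=> l le_lk; have [->|nli] := eqVneq l i.
      by rewrite (eqP xi0) add0n (leq_ltn_trans (le_q _ _)).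
    have [->|nlo] := eqVneq l o.
      by rewrite vswapr (eqP yi0) addn0 (leq_ltn_trans (le_q _ _)).
    by rewrite vswap_id //; apply/disj/neq_o.
  - move=> l lt_kl; rewrite vswap_id ?same 1?ltnW // -val_eqE /=.
      by rewrite gtn_eqF // (ltn_trans lt_ik).
    by rewrite gtn_eqF.
  rewrite card_heavy.
  apply: (@leq_trans #|i |: [set l in prefix_zeros k x | y l != 0 :> nat]|).
    apply/subset_leq_card/subsetP => l; rewrite !inE.
    have [//|nli] := eqVneq l i; have [->|nlo] := eqVneq l o.
      by rewrite vswapr yi0 andbF.
    by rewrite vswap_id // => /andP[/andP[le_lk ->] ->]; rewrite neq_o.
  by rewrite cardsU1; case: (_ \notin _); rewrite ?add1n ?ltnS // leqW.
have [y [Fy disj _ _]] := step n (leqnn n).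
(* A heavy entry doubled is at least [s], so [x] would meet itself at [i0]. *)
have nxy : x != y.
  apply: contraTneq heavy_i0 => exy; have := disj i0 (ltn_ord i0).
  by rewrite -exy -ltnNge /c; lia.
have /sum_intersectP[k] := intF _ _ Fx Fy nxy.
by rewrite leqNgt disj.
Qed.

End Shifting.

(** * Binomial estimates *)

Lemma bin_sub_ge n t k : t <= n -> 'C(n, k.+1) <= 'C(n - t, k.+1) + t * 'C(n, k).
Proof.
elim: t => [|t IHt] le_tn; first by rewrite subn0 leq_addr.
apply: leq_trans (IHt (ltnW le_tn)) _.
have := leq_bin2l k (leq_subr t.+1 n).
by rewrite -(subnSK le_tn) binS mulSn; lia.
Qed.

(** The excluded vectors, counted by the last binomial, must pay for the excess of the ballot bound
    and for the one member without heavy entries. *)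
Lemma binomial_gap q p r n : 2 <= q -> 2 * p <= q.+1 -> q * r.+1 ^ 2 <= n.+1 ->
  p * 'C(n.+1, r) + 1 <= p * 'C(n, r) + 'C(n - r.+1, r).
Proof.
move=> hq hp hn; case: r hn => [|k] hn; first by rewrite !bin0 leqnn.
have {}hn : q * (k + 2) * (k + 2) <= n.+1 by move: hn; rewrite !expnS expn0; nia.
have le_kn : k.+2 <= n by nia.
(* In units of ['C(n, k)]: [p] for Pascal's rule, [k + 2] for [bin_sub_ge] and 1 for the added unit.
   The ratio of ['C(n, k.+1)] to ['C(n, k)] is [(n - k) / (k + 1)]. *)
have gapn : (p + k + 3) * k.+1 <= n - k by nia.
have := bin_sub_ge k le_kn; rewrite binS mulnDr.
have Ckn : 0 < 'C(n, k) by rewrite bin_gt0; lia.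
have : (p + k + 3) * 'C(n, k) <= 'C(n, k.+1).
  by rewrite -(leq_pmul2l (ltn0Sn k)) mul_bin_left; nia.
by nia.
Qed.

(** * The upper bounds *)

Section UpperBounds.
Variables q s : nat.
Hypotheses (hq : 2 <= q) (lt_qs : q < s).
Let c := uphalf s.
Let p := q.+1 - c.

(** At most one member of [F] lies outside [R], and [F] misses the subset [L] of [R], so
    [#|F| <= #|R| - #|L| + 1]. *)
Lemma shifted_low_head_bound n r (F : {set qvec q n.+1}) x : s <= 2 * q ->
  q * r.+1 ^ 2 <= n.+1 -> support_uniform r.+1 F -> sum_intersecting s F ->
  left_shifted F -> x \in F -> x ord0 + c < s ->
  #|F| <= p * (q ^ r * 'C(n, r)).
Proof.
move=> hs hn uniF intF shF Fx x0.
have c_gt0 : 0 < c by rewrite /c; lia.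
have lt_cq : c < q.+1 by rewrite /c; lia.
pose R := [set y : qvec q n.+1 | (#|support y| == 1 + r) && reaches c 1 y].
pose D := [set y : qvec q n |
  (#|support y| == r) && [disjoint support (vtail x) & support y]].
pose L := [set vcons (Ordinal lt_cq) y | y in D].
have cardR : #|R| <= p ^ 1 * q ^ r * 'C(n.+1, r) by apply: card_reaches => //; apply: ltnW.
(* The first entry of [x] may be zero, so its tail can have up to [r + 1] nonzero entries. *)
have cardL : 'C(n - r.+1, r) * q ^ r <= #|L|.
  rewrite card_imset => [|y z /(congr1 (@vtail q n))]; last by rewrite !vtail_vcons.
  rewrite card_disjoint_support leq_mul2r leq_bin2l ?orbT // leq_sub2l //.
  rewrite -(uniF x Fx) -{2}(vcons_vtail x) card_support_vcons.
  exact: leq_addl.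
have LR : L \subset R.
  apply/subsetP => _ /imsetP[y + ->]; rewrite !inE => /andP[/eqP supp_y _].
  rewrite card_support_vcons supp_y.
  have -> : Ordinal lt_cq != 0 :> nat by rewrite -lt0n.
  (* The prefix of length 1 suffices: its only entry is [c]. *)
  rewrite eqxx; apply/existsP; exists (Ordinal (isT : 1 < n.+2)).
  rewrite card_prefix_zeros_vcons card_prefix_heavy_vcons leqnn.
  rewrite [#|prefix_zeros _ _|]eq_card0 => [|i]; last by rewrite !inE.
  by rewrite /=; move: c_gt0; case: (c).
have FL : [disjoint F :&: R & L].
  apply/pred0P => y; rewrite /= in_setI.
  apply/negP => /andP[/andP[Fy _] /imsetP[z + def_y]].
  rewrite inE => /andP[_ dis].
  have nxy : x != y.
    by apply: contraTneq x0 => ->; rewrite def_y vcons0 /= /c; lia.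
  have /sum_intersectP[k] := intF _ _ Fx Fy nxy; rewrite def_y.
  case: (unliftP ord0 k) => [l|] ->; last by rewrite vcons0 leqNgt x0.
  rewrite vconsS -vtailE; move/pred0P/(_ l): dis; rewrite /= !inE => /negbT.
  rewrite negb_and !negbK => /orP[]/eqP->; rewrite ?add0n ?addn0 leqNgt.
    by rewrite (leq_ltn_trans _ lt_qs) // -ltnS ltn_ord.
  by rewrite (leq_ltn_trans _ lt_qs) // -ltnS ltn_ord.
have FR : #|F :\: R| <= 1.
  have light y : y \in F :\: R -> y \in F /\ forall i, y i < c.
    rewrite !inE => /andP[+ Fy]; rewrite (uniF y Fy) eqxx /= => nR; split=> // i.
    rewrite ltnNge; apply: contra nR => ci.
    by apply: shifted_reaches lt_qs shF intF Fy _; apply/existsP; exists i.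
  apply/card_le1_eqP => y z /light[Fy ly] /light[Fz lz].
  exact: light_unique intF Fz Fy lz ly.
have FRL : #|F :&: R| + #|L| <= #|R|.
  rewrite -cardsUI (eqP (_ : _ :&: L == set0)) ?setI_eq0 // cards0 addn0.
  by apply: subset_leq_card; rewrite subUset subsetIr.
have hp : 2 * p <= q.+1 by rewrite /p /c; lia.
have := binomial_gap hq hp hn.
have q_gt0 : 0 < q ^ r by rewrite expn_gt0 (ltnW hq).
rewrite -(leq_pmul2l q_gt0) -(cardsID R F); rewrite expn1 in cardR.
move: #|F :&: R| #|F :\: R| #|L| #|R| FR FRL cardR cardL => u v l m.
move: p (q ^ r) 'C(n.+1, r) 'C(n, r) 'C(n - r.+1, r) q_gt0 {hp} => P Q C1 C0 Cd.
by nia.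
Qed.

Lemma heavy_head_bound n r (F : {set qvec q n.+1}) : c <= q.+1 ->
  support_uniform r.+1 F -> (forall x, x \in F -> c <= x ord0) ->
  #|F| <= p * (q ^ r * 'C(n, r)).
Proof.
move=> le_cq uniF headF; rewrite -[#|F|]cardsE card_vcons.
have := sum_threshold (fun=> 0) (q ^ r * 'C(n, r)) le_cq.
rewrite [X in _ = X + _]big1 // add0n => <-; apply: leq_sum => a _.
have c_gt0 : 0 < c by rewrite /c; lia.
case: ltnP => ca.
  rewrite leqn0 cards_eq0 -subset0; apply/subsetP => x; rewrite !inE.
  by move/headF; rewrite vcons0 leqNgt ca.
rewrite mulnC -card_support_eq; apply/subset_leq_card/subsetP => x; rewrite !inE.
move/uniF; rewrite card_support_vcons.
have -> : (a != 0 :> nat) by lia.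
by rewrite add1n => -[->].
Qed.

Lemma bound_even n r (F : {set qvec q n}) : ~~ odd s -> s <= 2 * q ->
  q * r.+1 ^ 2 <= n -> support_uniform r.+1 F -> sum_intersecting s F ->
  #|F| <= p * (q ^ r * 'C(n.-1, r)).
Proof.
move=> even_s hs hn uniF intF.
case: n F hn uniF intF => [|n] F hn uniF intF; first by nia.
have [G [uniG intG <- shG]] := exists_left_shifted uniF intF.
have [/existsP[x /andP[Gx x0]]|/existsPn high] :=
    boolP [exists x, (x \in G) && (x ord0 + c < s)].
  exact: shifted_low_head_bound intG shG Gx x0.
(* For even [s], [s - c = c], so every first entry is heavy. *)
apply: heavy_head_bound uniG _ => [|x Gx]; first by rewrite /c; lia.
by have := high x; rewrite Gx /c; lia.
Qed.

Definition odd_bound r n := 1 + p * \sum_(1 <= i < r.+1) 'C(n - i, r - i) * q ^ (r - i).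

(** The term [i = 1] accounts for heavy first entries, the rest for the slice with first entry
    [c - 1]. *)
Lemma odd_boundS r n : odd_bound r.+1 n.+1 = p * (q ^ r * 'C(n, r)) + odd_bound r n.
Proof.
rewrite /odd_bound big_nat_recl // !subSS !subn0 mulnDr addnCA ['C(n, r) * _]mulnC.
by congr (_ + (_ + _ * _)); rewrite big_add1.
Qed.

Lemma bound_odd n r (F : {set qvec q n}) : odd s -> s <= 2 * q + 1 ->
  q * r ^ 2 <= n -> support_uniform r F -> sum_intersecting s F ->
  #|F| <= odd_bound r n.
Proof.
move=> odd_s hs; elim: r n F => [|r IHr] n F hn uniF intF.
  have light z (i : 'I_n) : z \in F -> z i < uphalf s.
    by move/uniF/cards0_eq/setP/(_ i); rewrite !inE => /negbFE/eqP->; lia.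
  apply: leq_trans (leq_addr _ _); apply/card_le1_eqP => x y Fx Fy.
  by apply: (light_unique intF Fy Fx) => i; apply: light.
(* For [s = 2 * q + 1] no entry is heavy, so [F] has at most one member. *)
have [s_max|s_le] := ltnP (2 * q) s.
  apply: leq_trans (leq_addr _ _); apply/card_le1_eqP => x y Fx Fy.
  have c_max : c = q.+1 by rewrite /c; lia.
  by apply: (light_unique intF Fy Fx) => i; rewrite -/c c_max ltn_ord.
case: n F hn uniF intF => [|n] F hn uniF intF; first by nia.
have [G [uniG intG <- shG]] := exists_left_shifted uniF intF; rewrite odd_boundS.
have [/existsP[x /andP[Gx x0]]|/existsPn high] :=
    boolP [exists x, (x \in G) && (x ord0 + c < s)].
  by apply: leq_trans (leq_addr _ _); exact: shifted_low_head_bound intG shG Gx x0.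
have lt_cq : c.-1 < q.+1 by rewrite /c; lia.
pose H := [set y | vcons (Ordinal lt_cq) y \in G].
pose G1 := [set x in G | c <= x ord0].
have G1_le : #|G1| <= p * (q ^ r * 'C(n, r)).
  apply: heavy_head_bound; first by rewrite /c; lia.
    by move=> x; rewrite inE => /andP[/uniG].
  by move=> x; rewrite inE => /andP[].
have H_le : #|H| <= odd_bound r n.
  apply: IHr; first by move: hn; rewrite !expnS !expn0; nia.
    move=> y; rewrite inE => /uniG; rewrite card_support_vcons.
    have -> : Ordinal lt_cq != 0 :> nat by rewrite /= /c; lia.
    by rewrite add1n => -[].
  move=> y z; rewrite !inE => Gy Gz nyz.
  have nvyz : vcons (Ordinal lt_cq) y != vcons (Ordinal lt_cq) z.
    by apply: contraNneq nyz => /(congr1 (@vtail q n)); rewrite !vtail_vcons => ->.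
  have /sum_intersectP[k] := intG _ _ Gy Gz nvyz.
  (* Two first entries [c - 1] sum to [s - 1], so the meeting is in the tails. *)
  case: (unliftP ord0 k) => [l|] ->; last by rewrite !vcons0 /= /c; lia.
  by rewrite !vconsS => le_s; apply/sum_intersectP; exists l.
apply: leq_trans (leq_add G1_le H_le).
have GH : G \subset G1 :|: [set vcons (Ordinal lt_cq) y | y in H].
  apply/subsetP => x Gx; rewrite !inE Gx /=; case: leqP => //= x0.
  have ex0 : x ord0 = Ordinal lt_cq.
    by apply/val_inj => /=; have := high x; rewrite Gx /= -leqNgt /c; rewrite /c in x0; lia.
  apply/imsetP; exists (vtail x); last by rewrite -ex0 vcons_vtail.
  by rewrite inE -ex0 vcons_vtail.
apply: leq_trans (subset_leq_card GH) _; apply: leq_trans (leq_card_setU _ _) _.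
by rewrite leq_add2l leq_imset_card.
Qed.

End UpperBounds.

(** * Extremal families *)

Section Constructions.
Variables q s : nat.
Hypotheses (hq : 2 <= q) (lt_qs : q < s).
Let c := uphalf s.
Let p := q.+1 - c.

Lemma even_construction n r : s <= 2 * q ->
  exists F : {set qvec q n.+1}, [/\ support_uniform r.+1 F, sum_intersecting s F
    & #|F| = p * (q ^ r * 'C(n, r))].
Proof.
move=> hs; have c_gt0 : 0 < c by rewrite /c; lia.
exists [set x | (#|support x| == r.+1) && (c <= x ord0)]; split.
- by move=> x; rewrite inE => /andP[/eqP].
- move=> x y; rewrite !inE => /andP[_ cx] /andP[_ cy] _; apply/sum_intersectP.
  by exists ord0; apply: leq_trans (leq_add cx cy); rewrite /c; lia.
have le_cq : c <= q.+1 by rewrite /c; lia.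
have := sum_threshold (fun=> 0) (q ^ r * 'C(n, r)) le_cq.
rewrite [X in _ = X + _]big1 // add0n => <-; rewrite card_vcons; apply: eq_bigr => a _.
case: ltnP => ca; first by apply: eq_card0 => x; rewrite !inE vcons0 leqNgt ca andbF.
rewrite mulnC -card_support_eq; apply: eq_card => x.
rewrite !inE vcons0 ca andbT card_support_vcons.
by have -> : (a != 0 :> nat) by lia.
Qed.

(** Recursively, the first entry is heavy, or it is [c - 1] and the tail lies in the previous
    family. Since [c + (c - 1) = s], a heavy first entry meets either kind. The recursion starts
    from the zero vector alone. *)
Lemma odd_construction n r : odd s -> s <= 2 * q + 1 -> r <= n ->
  exists F : {set qvec q n}, [/\ support_uniform r F, sum_intersecting s F
    & #|F| = odd_bound q s r n].
Proof.
move=> odd_s hs; have le_cq : c <= q.+1 by rewrite /c; lia.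
have c_gt0 : 0 < c by rewrite /c; lia.
elim: r n => [|r IHr] n le_rn.
  exists [set [ffun=> ord0]]; split.
  - by move=> x /set1P->; apply: eq_card0 => i; rewrite !inE ffunE.
  - by move=> x y /set1P-> /set1P->; rewrite eqxx.
  by rewrite cards1 /odd_bound big_geq ?muln0.
case: n le_rn => // n le_rn; have [F [uniF intF cardF]] := IHr n le_rn.
exists [set x : qvec q n.+1 | if c <= x ord0 then #|support x| == r.+1
  else (x ord0 == c.-1 :> nat) && (vtail x \in F)]; split.
- move=> x; rewrite inE; case: leqP => [_ /eqP //|_ /andP[/eqP x0 Fx]].
  rewrite -(vcons_vtail x) card_support_vcons (uniF _ Fx) x0.
  by have -> : c.-1 != 0 by rewrite /c; lia.
- move=> x y; rewrite !inE => Px Py nxy; apply/sum_intersectP.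
  case: leqP Px => [cx _|_ /andP[/eqP x0 Fx]]; case: leqP Py => [cy _|_ /andP[/eqP y0 Fy]].
  + by exists ord0; apply: leq_trans (leq_add cx cy); rewrite /c; lia.
  + by exists ord0; rewrite y0; rewrite /c in cx *; lia.
  + by exists ord0; rewrite x0; rewrite /c in cy *; lia.
  have nxy' : vtail x != vtail y.
    apply: contraNneq nxy => exy; rewrite -(vcons_vtail x) exy.
    by rewrite (_ : x ord0 = y ord0) ?vcons_vtail //; apply/val_inj; rewrite /= x0 y0.
  have /sum_intersectP[k] := intF _ _ Fx Fy nxy'.
  by rewrite !vtailE; exists (lift ord0 k).
rewrite odd_boundS -cardF card_vcons.
rewrite (eq_bigr (fun a : 'I_q.+1 => if a < c then (if a == c.-1 :> nat then #|F| else 0)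
  else q ^ r * 'C(n, r))).
  rewrite (sum_threshold (fun a => if a == c.-1 then #|F| else 0)) // addnC.
  congr (_ + _); case: c c_gt0 => // c' _; rewrite big_ord_recr /= eqxx big1 // => a _.
  by rewrite ltn_eqF.
move=> a _; case: ltnP => ca.
  case: eqP => a0; last first.
    by apply: eq_card0 => x; rewrite !inE vcons0 leqNgt ca (introF eqP a0).
  by apply: eq_card => x; rewrite !inE vcons0 leqNgt ca a0 eqxx vtail_vcons.
rewrite mulnC -card_support_eq; apply: eq_card => x.
rewrite !inE vcons0 ca card_support_vcons.
by have -> : (a != 0 :> nat) by lia.
Qed.

End Constructions.

Theorem theorem1p3 (q s r n : nat)
    (hq : 2 <= q) (hqs : q < s) (hs : s <= 2 * q + 1)
    (hr : 1 <= r) (hn : q * r ^ 2 <= n) :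
  (forall F : {set qvec q n},
      support_uniform r F -> sum_intersecting s F -> #|F| <= sum_bound q s r n)
  /\ (exists F : {set qvec q n},
      [/\ support_uniform r F, sum_intersecting s F & #|F| = sum_bound q s r n]).
Proof.
have le_rn : r <= n by move: hn; rewrite !expnS expn0; nia.
rewrite /sum_bound; case: ifPn => [odd_s|even_s].
  split; first by move=> F; apply: bound_odd.
  exact: odd_construction.
have {}hs : s <= 2 * q by lia.
have -> : s./2 = uphalf s by rewrite uphalf_half (negPf even_s).
case: r hr hn le_rn => // r _ hn le_rn; rewrite !subn1 -mulnA.
split; first by move=> F; apply: bound_even.
by case: n le_rn hn => // n _ _; apply: even_construction.
Qed.
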